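(* Let $G$ be an Abelian group of unbounded exponent, i.e., $\sup_{g\in G}o(g)=\infty$, where $o(g)$ denotes the order of $g$. Then convolution in $\ell_1(G)$ is not uniformly open.
   Context: $G$ is regarded as a discrete group (elements may have infinite order, in which case $o(g)=\infty$). $\ell_1(G)$ is the complex Banach algebra of absolutely summable families $x=(x_s)_{s\in G}$ with the $\ell_1$-norm and the convolution product $x*y=\sum_{t\in G}\big(\sum_{r\cdot s=t}x_ry_s\big)e_t$, where $(e_t)_{t\in G}$ is the canonical unit vector basis and $\cdot$ denotes the group operation. A map $f\colon X\to Y$ between metric spaces is uniformly open if for every $\varepsilon>0$ there is $\delta>0$ such that $f(B(x,\varepsilon))\supseteq B(f(x),\delta)$ for all $x\in X$. Convolution is uniformly open if the map $(x,y)\mapsto x*y$ from $\ell_1(G)\times\ell_1(G)$ (with the maximum norm) to $\ell_1(G)$ is uniformly open. *)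

(* Defs.v *)
From HB Require Import structures.
From mathcomp Require Import all_boot all_order all_algebra.
From mathcomp Require Import all_classical all_reals all_analysis.
From mathcomp Require Import complex.

Set Implicit Arguments.
Unset Strict Implicit.
Unset Printing Implicit Defensive.

Import Order.TTheory GRing.Theory Num.Theory.
Import numFieldNormedType.Exports.
Import Normc.

Local Open Scope classical_set_scope.
Local Open Scope ring_scope.

Section group_order.
Variables (R : realType) (G : zmodType).

(* The infimum of the empty set is +oo, so elements of infinite order have
   order +oo. *)
Definition group_order (g : G) : \bar R :=
  ereal_inf [set (n%:R)%:E | n in [set n : nat | (0 < n)%N /\ g *+ n = 0]].

Definition unbounded_exponent : Prop :=
  ereal_sup (range group_order) = +oo%E.

End group_order.

(* When K is R[i], 0 < e means that e is a positive real number. *)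
Definition uniformly_open (K : numDomainType) (X Y : pseudoMetricType K)
    (f : X -> Y) : Prop :=
  forall e : K, 0 < e -> exists2 d : K, 0 < d &
    forall x : X, ball (f x) d `<=` f @` ball x e.

Section unordered_sums.
Variables (R : realType) (T : choiceType).
Local Open Scope ereal_scope.

(* esum only has the expected meaning on nonnegative families, so a signed
   family is summed through its positive and negative parts, and a complex one
   through its real and imaginary parts; this is the usual unordered sum of
   absolutely summable families. *)
Definition rsum (D : set T) (f : T -> R) : R :=
  fine (\esum_(i in D) (EFin \o f)^\+ i - \esum_(i in D) (EFin \o f)^\- i).

Definition csum (D : set T) (f : T -> R[i]) : R[i] :=
  Complex (rsum D (fun i => complex.Re (f i)))
          (rsum D (fun i => complex.Im (f i))).

End unordered_sums.

Section esum_facts.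
Variable R : realType.
Local Open Scope ereal_scope.

Lemma le_esumZl (T : choiceType) (D : set T) (a : R) (g : T -> \bar R) :
  (0 <= a)%R -> (forall i, 0 <= g i) ->
  \esum_(i in D) (a%:E * g i) <= a%:E * \esum_(i in D) g i.
Proof.
move=> a0 g0; apply: ge_ereal_sup => _ [X [finX XD] <-].
rewrite fsbig_finite//= -ge0_sume_distrr//.
rewrite lee_wpmul2l ?lee_fin// esum_ge//.
by exists X => //; rewrite fsbig_finite.
Qed.

Lemma ge0_esumZl (T : choiceType) (D : set T) (a : R) (g : T -> \bar R) :
  (0 <= a)%R -> (forall i, 0 <= g i) ->
  \esum_(i in D) (a%:E * g i) = a%:E * \esum_(i in D) g i.
Proof.
move=> a0 g0; apply/eqP; rewrite eq_le le_esumZl//=.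
have [->|an0] := eqVneq a 0%R.
  by rewrite mul0e esum_ge0// => i _; rewrite mul0e.
have ap : (0 < a)%R by rewrite lt_neqAle eq_sym an0.
rewrite -lee_pdivlMl//.
rewrite (le_trans _ (le_esumZl _ _ _)) ?invr_ge0//; last first.
  by move=> i; rewrite mule_ge0.
by apply: le_esum => i _; rewrite muleA -EFinM mulVf// mul1e.
Qed.

Lemma normc_ge0 (z : R[i]) : (0 <= normc z)%R.
Proof. by case: z => a b /=; exact: sqrtr_ge0. Qed.

Lemma normc_norm (z : R[i]) : `|z|%R = ((normc z)%:C%C)%R.
Proof. by []. Qed.

Lemma Re_le_normc (z : R[i]) : (`|complex.Re z| <= normc z)%R.
Proof. by case: z => a b /=; rewrite -sqrtr_sqr ler_wsqrtr// lerDl sqr_ge0. Qed.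

Lemma Im_le_normc (z : R[i]) : (`|complex.Im z| <= normc z)%R.
Proof. by case: z => a b /=; rewrite -sqrtr_sqr ler_wsqrtr// lerDr sqr_ge0. Qed.

Lemma normc_le_ReIm (z : R[i]) :
  (normc z <= `|complex.Re z| + `|complex.Im z|)%R.
Proof.
case: z => a b /=; rewrite -[leRHS]ger0_norm ?addr_ge0// -sqrtr_sqr.
rewrite ler_wsqrtr// sqrrD !real_normK ?num_real//.
by rewrite lerD2r lerDl mulrn_wge0// mulr_ge0.
Qed.

Lemma abs_rsum_le (T : choiceType) (D : set T) (f : T -> R) :
  (`|rsum D f|)%:E <= \esum_(i in D) (`|f i|)%:E.
Proof.
rewrite /rsum; set A := esum D _; set B := esum D _.
have A0 : 0 <= A by apply: esum_ge0 => i _; exact: funepos_ge0.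
have B0 : 0 <= B by apply: esum_ge0 => i _; exact: funeneg_ge0.
have -> : \esum_(i in D) (`|f i|)%:E = A + B.
  rewrite -esumD => [|i _|i _]; [|exact: funepos_ge0|exact: funeneg_ge0].
  apply: eq_esum => i _.
  by rewrite -[LHS]/((abse \o (EFin \o f)) i) fune_abse.
apply: (@le_trans _ _ `|A - B|); first by case: (A - B) => [r||] //=; rewrite normr0 leey.
by rewrite (le_trans (lee_abs_sub _ _))// !gee0_abs.
Qed.

Lemma normc_csum_le (T : choiceType) (D : set T) (f : T -> R[i]) :
  (normc (csum D f))%:E <= 2%:E * \esum_(i in D) (normc (f i))%:E.
Proof.
rewrite (@le_trans _ _ (\esum_(i in D) (`|complex.Re (f i)|)%:E +
                        \esum_(i in D) (`|complex.Im (f i)|)%:E))//.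
  apply: le_trans (leeD (abs_rsum_le _ _) (abs_rsum_le _ _)).
  by rewrite -EFinD lee_fin (le_trans (normc_le_ReIm _)).
rewrite mule_natl mule2n leeD// le_esum// => i _; rewrite lee_fin.
  exact: Re_le_normc.
exact: Im_le_normc.
Qed.

End esum_facts.

Section ell1_type.
Variables (R : realType) (G : choiceType).
Implicit Types (f g : G -> R[i]^o).

Definition abs_summable : {pred G -> R[i]^o} :=
  fun f => `[< (\esum_(s in [set: G]) (normc (f s))%:E < +oo)%E >].

Lemma esum_normcZ (a : R[i]) f :
  (\esum_(s in [set: G]) (normc (a * f s))%:E =
   (normc a)%:E * \esum_(s in [set: G]) (normc (f s))%:E)%E.
Proof.
rewrite -ge0_esumZl ?normc_ge0// => [|i]; last by rewrite lee_fin normc_ge0.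
by apply: eq_esum => s _; rewrite normcM EFinM.
Qed.

Lemma esum_normcD f g :
  (\esum_(s in [set: G]) (normc (f s + g s))%:E <=
   \esum_(s in [set: G]) (normc (f s))%:E +
   \esum_(s in [set: G]) (normc (g s))%:E)%E.
Proof.
rewrite -esumD; try by move=> s _; rewrite lee_fin normc_ge0.
by apply: le_esum => s _; rewrite -EFinD lee_fin le_normcD.
Qed.

Lemma abs_summable_submod : submod_closed abs_summable.
Proof.
split.
  apply/asboolP; rewrite esum1 ?ltry// => s _.
  by rewrite [normc _](@normc0 R).
move=> a f g /asboolP fs /asboolP gs; apply/asboolP.
apply: le_lt_trans (esum_normcD (a *: f) g) _.
rewrite lte_add_pinfty// esum_normcZ lte_mul_pinfty// ?lee_fin ?normc_ge0//.
Qed.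

HB.instance Definition _ := GRing.isSubmodClosed.Build _ _ abs_summable
  abs_summable_submod.

Record ell1 := Ell1 { ell1_val :> G -> R[i]^o; _ : ell1_val \in abs_summable }.

HB.instance Definition _ := [isSub for ell1_val].
HB.instance Definition _ := [Choice of ell1 by <:].
HB.instance Definition _ := [SubChoice_isSubLmodule of ell1 by <:].

Definition ell1_norm (x : ell1) : R :=
  fine (\esum_(s in [set: G]) (normc (x s))%:E).

Lemma ell1_normE (x : ell1) :
  (ell1_norm x)%:E = (\esum_(s in [set: G]) (normc (x s))%:E)%E.
Proof.
case: x => f fsP; have /asboolP fs := fsP.
rewrite /ell1_norm fineK// ge0_fin_numE//.
by apply: esum_ge0 => s _; rewrite lee_fin normc_ge0.
Qed.

Lemma ler_ell1_normD (x y : ell1) :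
  ((ell1_norm (x + y))%:C <= (ell1_norm x)%:C + (ell1_norm y)%:C)%C.
Proof.
rewrite -rmorphD lecR -lee_fin EFinD !ell1_normE; exact: esum_normcD.
Qed.

Lemma ell1_normZ (a : R[i]) (x : ell1) :
  (ell1_norm (a *: x))%:C%C = `|a| * (ell1_norm x)%:C%C.
Proof.
rewrite normc_norm -rmorphM; congr (_%:C)%C; apply: EFin_inj.
by rewrite EFinM !ell1_normE -esum_normcZ.
Qed.

Lemma ell1_norm0_eq0 (x : ell1) : (ell1_norm x)%:C%C = 0 -> x = 0.
Proof.
move=> /complexI x0; apply/val_inj/funext => s /=; apply: eq0_normc.
apply/eqP; rewrite eq_le normc_ge0 andbT -lee_fin -[leRHS]/(0%R)%:E -x0.
rewrite ell1_normE esum_ge//; exists [set s] => //.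
by rewrite fsbig_set1.
Qed.

(* The norm is the real number ell1_norm x seen in R[i], as required of a
   normed space over R[i]. *)
HB.instance Definition _ := Lmodule_isNormed.Build R[i] ell1
  ler_ell1_normD ell1_normZ ell1_norm0_eq0.

Lemma normr_ell1E (x : ell1) : `|x| = (ell1_norm x)%:C%C.
Proof. by []. Qed.

Lemma ball_ell1E (x y : ell1) (e : R) :
  ball x e%:C%C y <-> ell1_norm (x - y) < e.
Proof. by rewrite -ltcR -ball_normE. Qed.

End ell1_type.

Section convolution.
Variables (R : realType) (G : zmodType).
Implicit Types x y : ell1 R G.

Definition conv_coef x y (t : G) : R[i]^o :=
  csum [set p : G * G | p.1 + p.2 = t] (fun p => x p.1 * y p.2).

Lemma conv_coef_summable x y : conv_coef x y \in @abs_summable R G.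
Proof.
apply/asboolP; pose F (s r : G) := (normc (x s) * normc (y r))%:E.
have F0 s r : (0 <= F s r)%E by rewrite lee_fin mulr_ge0// normc_ge0.
apply: (@le_lt_trans _ _ (2%:E * \esum_(s in [set: G])
    \esum_(r in [set: G]) F s r)%E).
  rewrite esum_esum// (reindex_esum
    ([set: G] `*`` (fun t => [set p : G * G | p.1 + p.2 = t])) _
    (fun q => q.2)) /=; last first.
    split=> //= [[t p] [t' p']|p _]; last by exists (p.1 + p.2, p).
    by rewrite !inE /= => -[_ <-] [_ <-] ->.
  rewrite -(esum_esum (a := fun _ p => F p.1 p.2))//.
  rewrite -ge0_esumZl// => [|t]; last exact: esum_ge0.
  apply: le_esum => t _; rewrite /conv_coef.
  apply: le_trans (normc_csum_le _ _) _.
  rewrite lee_wpmul2l// le_esum// => p _.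
  by rewrite /F normcM.
rewrite lte_mul_pinfty// (_ : (\esum_(s in _) _)%E =
    (ell1_norm x * ell1_norm y)%:E) ?ltry//.
rewrite mulrC EFinM (ell1_normE x) -ge0_esumZl; last 2 first.
- by rewrite -lee_fin ell1_normE esum_ge0// => s _; rewrite lee_fin normc_ge0.
- by move=> s; rewrite lee_fin normc_ge0.
apply: eq_esum => s _; rewrite muleC ell1_normE -ge0_esumZl ?normc_ge0//.
by move=> r; rewrite lee_fin normc_ge0.
Qed.

Definition ell1_conv x y : ell1 R G := Ell1 (conv_coef_summable x y).

End convolution.

(* Main.v *)
Require Import Defs.
From mathcomp Require Import all_boot all_order all_algebra.
From mathcomp Require Import all_classical all_reals all_analysis.
From mathcomp Require Import complex.
From mathcomp Require Import ring lra zify.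

(** Uniform openness at the points (x, 0), whose product is 0, produces
    inverses with uniform bounds: for some d > 0, every x in ell_1(G) has x'
    within 1/2 of x and y' of norm less than 1/2 with x' * y' = (d/2) e_0.
    On the Fourier side, x' is near x and bounded away from 0 by a constant
    that does not depend on x.  A function on a space of dimension 2 can have a
    zero that no small perturbation removes, and G looks two-dimensional: if g
    has very large order and h = (M + 1) g with M large, then g and h satisfy
    no relation with small coefficients.  The element
    x = (e_g + e_{-g}) / 2 + i (e_h + e_{-h}) / 2 then plays the role of
    cos s + i cos t on the square [0, pi]^2, which keeps a zero under every
    perturbation of size less than 1.

    Two obstacles separate this picture from a proof.

    - An honest family of characters of G sending g and h to independent values
      need not exist, and the coefficients of x' may be spread over arbitrarily
      many elements.  Lemma concentration replaces x' and y' by their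
      restrictions to a finite set A whose size is bounded in terms of d alone,
      while the product remains close to (d/2) e_0.  This is a pigeonhole on the
      sizes of the coefficients: at a suitable scale, the coefficients of
      intermediate size carry little mass, and the smaller ones are far too
      small to interfere with the boundedly many sums of elements of A.

    - On a set A of bounded size only the additive relations between pairs of
      elements of A matter.  There are finitely many possible systems of such
      relations, so rational linear algebra (freiman_coordinates) gives a bound
      M that depends only on the size of A: if g and h satisfy no relation with
      coefficients at most M, then A has additive real coordinates lam, mu with
      values (1, 0) at g and (0, 1) at h.  The functions
      p |-> exp(i (s lam(p) + t mu(p))) then serve as characters on A, for all
      real s and t (char_sum_conv).

    The resulting function F(s, t) is within 1 of cos s + i cos t and bounded
    away from 0.  This contradicts planar_zero, a quantitative Poincare-Miranda
    theorem that follows from a Sperner parity count on a fine grid. *)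

Set Implicit Arguments.
Unset Strict Implicit.
Unset Printing Implicit Defensive.

Import Order.TTheory GRing.Theory Num.Theory.
Import numFieldNormedType.Exports.
Import Normc.

Local Open Scope ring_scope.

(** * Zeros in a square by a parity count *)

(** Grid points are labelled in option bool; these are the edges counted in
    Sperner's argument. *)
Definition door (a b : option bool) : bool :=
  (a == None) && (b == Some true) || (a == Some true) && (b == None).

Definition corners (lab : nat -> nat -> option bool) i j :=
  [:: lab i j; lab i.+1 j; lab i j.+1; lab i.+1 j.+1].

(** A square whose corners miss one of the three labels has an even number of
    doors on its boundary.  If every square were of this kind, the number of
    doors on a horizontal line would have the same parity at every height,
    because the vertical sides of the grid contain no door.  But the top line
    contains no door, and the bottom line goes from the label None to the label
    Some true without using the third one, so it has an odd number of doors. *)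
Lemma sperner_grid (lab : nat -> nat -> option bool) n :
  (forall j, (j <= n)%N -> lab 0%N j = None) ->
  (forall j, (j <= n)%N -> lab n j != None) ->
  (forall i, (i <= n)%N -> lab i 0%N != Some false) ->
  (forall i, (i <= n)%N -> lab i n != Some true) ->
  exists i j, [/\ (i < n)%N, (j < n)%N &
    forall c, exists a b : bool, lab (a + i)%N (b + j)%N = c].
Proof.
move=> left right bottom top.
pose P i j := all (mem (corners lab i j)) [:: None; Some true; Some false].
have [/existsP[[i j] /allP all_labels]|noP] :=
    boolP [exists ij : 'I_n * 'I_n, P ij.1 ij.2].
  exists i, j; split => // c.
  have : c \in corners lab i j by apply: all_labels; case: c => [[]|].
  rewrite !inE => /or4P[]/eqP->.
  - by exists false, false.
  - by exists true, false.
  - by exists false, true.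
  - by exists true, true.
pose row j k := \big[addb/false]_(i < k) door (lab i j) (lab i.+1 j).
have cell i j : (i < n)%N -> (j < n)%N ->
    door (lab i j) (lab i.+1 j) (+) door (lab i j.+1) (lab i.+1 j.+1) =
    door (lab i j) (lab i j.+1) (+) door (lab i.+1 j) (lab i.+1 j.+1).
  move=> ni nj; have: ~~ P i j.
    apply: contra noP => Pij.
    by apply/existsP; exists (Ordinal ni, Ordinal nj).
  rewrite /P /corners /= !inE.
  by move: (lab i j) (lab i.+1 j) (lab i j.+1) (lab i.+1 j.+1) =>
    [[]|] [[]|] [[]|] [[]|].
have rowS j k : (j < n)%N -> (k <= n)%N -> row j k (+) row j.+1 k =
    door (lab 0%N j) (lab 0%N j.+1) (+) door (lab k j) (lab k j.+1).
  move=> nj; elim: k => [|k IH] nk; first by rewrite /row !big_ord0 addFb addbb.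
  by rewrite /row !big_ord_recr /= addbACA IH 1?ltnW// cell// -addbA addKb.
have rowE j : (j <= n)%N -> row j n = row 0%N n.
  elim: j => // j IH nj; rewrite -IH ?(ltnW nj)//.
  have := rowS j n nj (leqnn n); rewrite left ?(ltnW nj)// left//.
  have := right _ nj; have := right _ (ltnW nj).
  by case: (lab n j) (lab n j.+1) => [[]|] [[]|] //= _ _;
    case: (row j n); case: (row j.+1 n).
have row0 k : (k <= n)%N -> row 0%N k = (lab k 0%N != None).
  elim: k => [|k IH] nk; first by rewrite /row big_ord0 left.
  rewrite /row big_ord_recr /= -/(row 0%N k) IH 1?ltnW//.
  have := bottom _ nk; have := bottom _ (ltnW nk).
  by case: (lab k 0%N) (lab k.+1 0%N) => [[]|] [[]|].
have rown k : (k <= n)%N -> row n k = false.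
  elim: k => [|k IH] nk; first by rewrite /row big_ord0.
  rewrite /row big_ord_recr /= -/(row n k) IH 1?ltnW//.
  have := top _ nk; have := top _ (ltnW nk).
  by case: (lab k n) (lab k.+1 n) => [[]|] [[]|].
by have := rowE n (leqnn n); rewrite rown// row0// right.
Qed.

(** The label records the sign of u first, and the sign of v only where u is
    not positive.  A square showing all three labels therefore has a change of
    sign of u and a change of sign of v among its corners, so u and v are both
    within their oscillation of 0 there. *)
Lemma grid_near_zero (R : realDomainType) (n : nat) (u v : nat -> nat -> R)
    (r : R) :
  (forall j, (j <= n)%N -> 0 < u 0%N j) ->
  (forall j, (j <= n)%N -> u n j < 0) ->
  (forall i, (i <= n)%N -> 0 < v i 0%N) ->
  (forall i, (i <= n)%N -> v i n < 0) ->
  (forall i j (a b : bool), (i < n)%N -> (j < n)%N ->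
    `|u (a + i)%N (b + j)%N - u i j| <= r /\
    `|v (a + i)%N (b + j)%N - v i j| <= r) ->
  exists i j, [/\ (i <= n)%N, (j <= n)%N, `|u i j| <= r & `|v i j| <= r].
Proof.
move=> left right bottom top osc.
pose lab i j := if 0 < u i j then None else Some (0 < v i j).
have [||||i [j [ni nj all_labels]]] := @sperner_grid lab n.
- by move=> j nj; rewrite /lab left.
- by move=> j nj; rewrite /lab ltNge ltW// right.
- by move=> i ni; rewrite /lab bottom//; case: ifP.
- by move=> i ni; rewrite /lab [0 < v i n]ltNge ltW ?top//; case: ifP.
exists i, j.
have [a1 [b1]] := all_labels None.
have [a2 [b2]] := all_labels (Some true).
have [a3 [b3]] := all_labels (Some false).
rewrite /lab; case: ifP => // /negbT; rewrite -leNgt => u3.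
move=> [/negbT]; rewrite -leNgt => v3.
case: ifP => // /negbT; rewrite -leNgt => u2 [v2]; case: ifP => // u1 _.
have [] := osc i j a1 b1 ni nj; have [] := osc i j a2 b2 ni nj.
have [] := osc i j a3 b3 ni nj; rewrite !ler_norml.
do 6 move=> /andP[? ?].
by split; try (exact: ltnW); apply/andP; split; lra.
Qed.

(** * Real coordinates on small subsets of an abelian group *)

Lemma common_denominator (I : finType) (f : I -> rat) :
  exists2 d : int, d != 0 &
    exists m : I -> int, forall i, d%:Q * f i = (m i)%:Q.
Proof.
exists (\prod_i denq (f i)); first by apply/prodf_neq0 => i _; exact: denq_neq0.
exists (fun i => (\prod_(j | j != i) denq (f j)) * numq (f i)) => i.
by rewrite (bigD1 i)//= !rmorphM/= numqE mulrAC mulrC mulrA mulrAC -mulrA mulrC.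
Qed.

(** A quadruple ((p, q), (p', q')) encodes the relation p + q = p' + q' between
    n elements of a group; None stands for the element 0, so that relations
    such as p + q = 0 are covered as well. *)
Section relations.
Variable n : nat.
Notation index := (option 'I_n).
Notation quad := ((index * index) * (index * index))%type.

Definition satisfies (V : zmodType) (rho : {set quad}) (a : 'I_n -> V) :=
  forall q : quad, q \in rho ->
    oapp a 0 q.1.1 + oapp a 0 q.1.2 = oapp a 0 q.2.1 + oapp a 0 q.2.2.

Definition coef (q : quad) (r : 'I_n) : int :=
  let c o : int := (o == Some r)%:R in c q.1.1 + c q.1.2 - c q.2.1 - c q.2.2.

Lemma sum_coef (V : zmodType) (a : 'I_n -> V) (q : quad) :
  \sum_r a r *~ coef q r =
  oapp a 0 q.1.1 + oapp a 0 q.1.2 - oapp a 0 q.2.1 - oapp a 0 q.2.2.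
Proof.
have sum1 (o : index) : \sum_r a r *~ ((o == Some r)%:R : int) = oapp a 0 o.
  case: o => [k|] /=; last by rewrite big1.
  rewrite (bigD1 k)//= eqxx mulr1z big1 ?addr0// => r rk.
  by rewrite (inj_eq Some_inj) eq_sym (negbTE rk) mulr0z.
rewrite -!sum1 -big_split -!sumrB /=; apply: eq_bigr => r _.
by rewrite /coef !mulrzBr mulrzDr.
Qed.

Definition separated (rho : {set quad}) (i j : 'I_n) :=
  exists lam mu : 'I_n -> rat,
    [/\ satisfies rho lam, satisfies rho mu, (lam i = 1) /\ (lam j = 0)
      & (mu i = 0) /\ (mu j = 1)].

Definition forced_relation (rho : {set quad}) (i j : 'I_n) (k l : int) :=
  ((k != 0) || (l != 0)) /\ forall (G : zmodType) (a : 'I_n -> G),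
    satisfies rho a -> a i *~ k + a j *~ l = 0.

(** If no nontrivial combination of the coordinate forms e_i and e_j lies in
    the rational row space of the relations, then the solution space of the
    relations maps onto the plane of the i-th and j-th coordinates.  Otherwise
    clearing denominators gives an integral consequence of the relations, valid
    in every abelian group. *)
Lemma relation_dichotomy (rho : {set quad}) (i j : 'I_n) :
  separated rho i j \/ exists k l, forced_relation rho i j k l.
Proof.
pose M := \matrix_(k < #|rho|, r < n) ((coef (enum_val k) r)%:~R : rat).
pose E : 'M[rat]_(2, n) :=
  \matrix_(k < 2, r < n) (r == if k == 0 then i else j)%:R.
(* The columns of cokermx M span the solution space, so E *m cokermx M is the
   restriction to it of the coordinates i and j. *)
case: (boolP (row_free (E *m cokermx M))) => [/row_freeP[B EB]|].
  left; pose C := cokermx M *m B.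
  have EC : E *m C = 1%:M by rewrite mulmxA.
  have MC : M *m C = 0 by rewrite mulmxA mulmx_coker mul0mx.
  have relC (k : 'I_2) : satisfies rho (fun r => C r k).
    move=> q qrho; have /matrixP/(_ (enum_rank_in qrho q) k) := MC.
    rewrite !mxE => H; apply/eqP.
    rewrite -subr_eq0 opprD addrA -sum_coef -[eqbRHS]H.
    apply/eqP/eq_bigr => r _; rewrite [M _ _]mxE enum_rankK_in//.
    by rewrite -mulrzr mulrC.
  have C1 (k l : 'I_2) : C (if k == 0 then i else j) l = (k == l)%:R.
    have /matrixP/(_ k l) := EC; rewrite [1%:M _ _]mxE => <-; rewrite [RHS]mxE.
    apply/esym; rewrite (bigD1 (if k == 0 then i else j))//=.
    rewrite big1 => [|r /negbTE rk]; last first.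
      by rewrite [E _ _]mxE rk mul0r.
    by rewrite [E _ _]mxE eqxx mul1r addr0.
  exists (fun r => C r 0), (fun r => C r 1).
  have := (C1 0 0, C1 0 1, C1 1 0, C1 1 1) => /= -[[[-> ->] ->] ->].
  by split => //; exact: relC.
rewrite -kermx_eq0 => /rowV0Pn[u]; rewrite sub_kermx => /eqP uE u0.
have /submxP[D uED] : (u *m E <= M)%MS by rewrite submxE -mulmxA uE.
pose c (x : 'I_2 + 'I_#|rho|) :=
  match x with inl k => u 0 k | inr q => D 0 q end.
have [d d0 [m1 dm1]] := common_denominator c.
pose m (x : 'I_2 + 'I_#|rho|) := m1 x.
have dm x : d%:Q * c x = (m x)%:Q := dm1 x.
have uk k : (m (inl k) == 0) = (u 0 k == 0).
  by rewrite -(intr_eq0 rat) -dm mulf_eq0 intr_eq0 (negbTE d0).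
pose k : int := m (inl (0 : 'I_2)); pose l : int := m (inl (1 : 'I_2)).
right; exists k, l; split.
  apply: contraNT u0; rewrite negb_or !negbK /k /l !uk.
  move=> /andP[/eqP u00 /eqP u01].
  apply/eqP/rowP; case=> [[|[|//]] k2]; rewrite [RHS]mxE;
    [rewrite -u00|rewrite -u01]; congr (u _ _); exact: val_inj.
move=> G a a_rho.
have key (r : 'I_n) : k * (r == i)%:R + l * (r == j)%:R =
    \sum_q m (inr q) * coef (enum_val q) r :> int.
  apply: (@intr_inj rat); rewrite rmorphD !rmorphM rmorph_sum/= /k /l -!dm/=.
  have /matrixP/(_ 0 r) := uED; rewrite !mxE big_ord_recl big_ord1 !mxE /=.
  rewrite (_ : lift _ _ = 1); last exact: val_inj.
  move=> /(congr1 ( *%R d%:Q)).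
  rewrite mulrDr mulr_sumr !mulrA !natz !pmulrn => ->.
  by apply: eq_bigr => q _; rewrite rmorphM/= -dm mxE mulrA.
have pick s (k' : int) : \sum_r a r *~ (k' * (r == s)%:R) = a s *~ k'.
  rewrite (bigD1 s)//= eqxx mulr1 big1 ?addr0// => r /negbTE->.
  by rewrite mulr0 mulr0z.
rewrite -!pick -big_split /=.
under eq_bigr => r _ do rewrite -mulrzDr key mulrz_sumr.
rewrite exchange_big big1 //= => q _.
under eq_bigr => r _ do rewrite mulrC mulrzA.
rewrite -mulrz_suml.
have := a_rho _ (enum_valP q) => /eqP.
rewrite -subr_eq0 opprD addrA -sum_coef => /eqP->.
by rewrite mul0rz.
Qed.

(** There are finitely many systems of relations on n elements, hence a bound
    on the coefficients that serves for all of them and for all groups. *)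
Lemma bounded_relation_dichotomy : exists M : nat, forall rho i j,
  separated rho i j \/
  exists k l : int,
    [/\ (`|k| <= M)%N, (`|l| <= M)%N & forced_relation rho i j k l].
Proof.
pose T : finType := ({set quad} * ('I_n * 'I_n))%type.
pose P (x : T) (M : nat) := separated x.1 x.2.1 x.2.2 \/ exists k l : int,
  [/\ (`|k| <= M)%N, (`|l| <= M)%N & forced_relation x.1 x.2.1 x.2.2 k l].
have /fin_all_exists[f Pf] : forall x : T, exists M, P x M.
  move=> [rho [i j]]; have [sep|[k [l kl]]] := relation_dichotomy rho i j.
    by exists 0%N; left.
  exists (maxn `|k| `|l|)%N; right; exists k, l.
  by split; rewrite ?leq_maxl ?leq_maxr.
exists (\max_(x : T) f x)%N => rho i j.
have fM : (f (rho, (i, j)) <= \max_(x : T) f x)%N.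
  by exact: (@leq_bigmax T f (rho, (i, j))).
have [sep|[k [l [kM lM kl]]]] := Pf (rho, (i, j)); first by left.
by right; exists k, l; split; [exact: leq_trans fM|exact: leq_trans fM|].
Qed.

End relations.

(** A Freiman homomorphism of order 2 is usually determined only up to a
    translation; the second condition normalizes it to respect 0. *)
Definition freiman_hom (G V : zmodType) (A : seq G) (f : G -> V) :=
  {in A & A, forall p q, {in A & A, forall p' q',
    p + q = p' + q' -> f p + f q = f p' + f q'}} /\
  {in A & A, forall p q, p + q = 0 -> f p + f q = 0}.

(** The bound M depends on the number of elements of A and not on the group: it
    turns independence of g and h up to a fixed size into genuine rational
    independence modulo the relations between pairs of elements of A. *)
Lemma freiman_coordinates (R : numFieldType) (K : nat) : exists M : nat,
  forall (G : zmodType) (A : seq G) (g h : G),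
  (size A <= K)%N -> g \in A -> h \in A ->
  (forall k l : int, (`|k| <= M)%N -> (`|l| <= M)%N ->
     g *~ k + h *~ l = 0 -> k = 0 /\ l = 0) ->
  exists lam mu : G -> R, [/\ freiman_hom A lam, freiman_hom A mu,
    (lam g = 1) /\ (lam h = 0) & (mu g = 0) /\ (mu h = 1)].
Proof.
case: K => [|K]; first by exists 0%N => G [|//] g h _; rewrite in_nil.
have [M HM] := bounded_relation_dichotomy K.+1.
exists M => G A g h AK gA hA indep.
pose a (i : 'I_K.+1) := nth 0 A i.
pose quad : finType := ((option 'I_K.+1 * option 'I_K.+1) *
                        (option 'I_K.+1 * option 'I_K.+1))%type.
pose rho := [set q : quad |
  oapp a 0 q.1.1 + oapp a 0 q.1.2 == oapp a 0 q.2.1 + oapp a 0 q.2.2].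
have a_rho : satisfies rho a by move=> q; rewrite inE => /eqP.
pose idx (p : G) : 'I_K.+1 := inord (index p A).
have aK : {in A, cancel idx a}.
  move=> p pA; rewrite /a /idx inordK ?nth_index//.
  by rewrite (leq_trans _ AK)// index_mem.
have lift (lam : 'I_K.+1 -> rat) : satisfies rho lam ->
    freiman_hom A (fun p => ratr (lam (idx p)) : R).
  move=> lam_rho; split=> [p q pA qA p' q' p'A q'A pq|p q pA qA pq].
    rewrite -!rmorphD; congr (ratr _).
    apply: (lam_rho ((Some (idx p), Some (idx q)),
                     (Some (idx p'), Some (idx q')))).
    by rewrite inE /= !aK// pq.
  rewrite -rmorphD -[RHS](rmorph0 (@ratr R)); congr (ratr _).
  have /= := lam_rho ((Some (idx p), Some (idx q)), (None, None)).
  by rewrite addr0; apply; rewrite inE /= !aK// pq addr0.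
have [[lam [mu [lam_rho mu_rho [lg lh] [mg mh]]]]|[k [l [kM lM [kl dep]]]]] :=
    HM rho (idx g) (idx h).
  exists (fun p => ratr (lam (idx p))), (fun p => ratr (mu (idx p))).
  by rewrite lg lh mg mh rmorph0 rmorph1; split => //; exact: lift.
have := dep _ _ a_rho; rewrite !aK// => /(indep _ _ kM lM)[k0 l0].
by rewrite k0 l0 eqxx in kl.
Qed.

(** * Concentration of an approximate product on few elements *)

(** The L bands are disjoint, so one of them carries at most the average
    mass. *)
Lemma light_band (R : realDomainType) (T : Type) (S : seq T) (w : T -> R)
    (W : R) (eta : nat -> R) (L : nat) :
  (forall s, 0 <= w s) -> \sum_(s <- S) w s <= W ->
  (forall k, eta k.+1 <= eta k) -> (0 < L)%N ->
  exists2 k, (k < L)%N &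
    (\sum_(s <- S | eta k.+1 <= w s < eta k) w s) *+ L <= W.
Proof.
move=> w0 wW eta_dec L0.
pose m k := \sum_(s <- S | eta k <= w s) w s.
have bandE k : \sum_(s <- S | eta k.+1 <= w s < eta k) w s = m k.+1 - m k.
  rewrite /m !(big_mkcond (fun s => _ <= _)) -sumrB big_mkcond /=.
  apply: eq_bigr => s _.
  have [le1|gt1] := leP (eta k) (w s).
    by rewrite (le_trans (eta_dec k))// andbF subrr.
  by rewrite andbT; case: ifP; rewrite subr0.
have [/existsP[k Hk]|] := boolP [exists k : 'I_L,
    (\sum_(s <- S | eta k.+1 <= w s < eta k) w s) *+ L <= W]; first by exists k.
move=> /existsPn no_k; suff : W *+ L < W *+ L by rewrite ltxx.
apply: (@lt_le_trans _ _ (\sum_(k < L) (m k.+1 - m k) *+ L)).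
  rewrite -[X in _ *+ X < _]card_ord -sumr_const; apply: ltr_sum => [|k _].
    by apply/hasP; exists (Ordinal L0); rewrite ?mem_index_enum.
  by rewrite -bandE ltNge; exact: no_k.
rewrite sumrMnl -(big_mkord xpredT (fun k => m k.+1 - m k)) telescope_sumr//.
rewrite lerMn2r; apply/orP; right.
have m0 k : 0 <= m k by apply: sumr_ge0.
apply: le_trans wW; apply: (@le_trans _ _ (m L)).
  by rewrite lerBlDr lerDl.
by rewrite /m big_mkcond; apply: ler_sum => s _; case: ifP.
Qed.

Lemma sum_eq_le1 (R : realDomainType) (T : eqType) (S : seq T) (x : T) :
  uniq S -> \sum_(s <- S) (x == s)%:R <= 1 :> R.
Proof.
move=> uS; rewrite -natr_sum.
rewrite (_ : \sum_(s <- S) _ = count_mem x S)%N; last first.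
  by rewrite -sum1_count [RHS]big_mkcond; apply: eq_bigr => s _;
    rewrite /= eq_sym; case: (s == x).
by rewrite count_uniq_mem//; case: (x \in S).
Qed.

(** pair_mass b t bounds the part of a convolution coefficient at t that comes
    from pairs whose first entry satisfies b.  When b selects few pairs by mass,
    the sum over all t is small (sum_pair_mass); when b selects small weights,
    each single t contributes little (pair_mass_le). *)
Section pair_mass.
Variables (R : realDomainType) (G : zmodType) (S : seq G) (w : G -> R).
Hypothesis w_ge0 : forall s, 0 <= w s.

Definition pair_mass (b : pred G) (t : G) : R :=
  \sum_(p <- S) \sum_(q <- S) (b p)%:R * w p * w q * (p + q == t)%:R.

Lemma sum_pair_mass (b : pred G) (T : seq G) : uniq T ->
  \sum_(t <- T) pair_mass b t <= (\sum_(s <- S | b s) w s) * \sum_(s <- S) w s.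
Proof.
move=> uT; rewrite /pair_mass exchange_big [X in X * _]big_mkcond mulr_suml /=.
apply: ler_sum => p _; rewrite exchange_big mulr_sumr /=.
apply: ler_sum => q _; rewrite -mulr_sumr; case: (b p); rewrite ?mul0r// mul1r.
by rewrite ler_piMr ?mulr_ge0// sum_eq_le1.
Qed.

Lemma pair_mass_le (b : pred G) (r : R) (t : G) : uniq S -> 0 <= r ->
  (forall s, b s -> w s <= r) -> pair_mass b t <= r * \sum_(s <- S) w s.
Proof.
move=> uS r0 br; rewrite /pair_mass exchange_big mulr_sumr /=.
apply: ler_sum => q _.
apply: (@le_trans _ _ (\sum_(p <- S) r * w q * (t - q == p)%:R)).
  apply: ler_sum => p _; rewrite subr_eq [t == _]eq_sym.
  rewrite ler_wpM2r// ler_wpM2r//.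
  by case: (boolP (b p)) => bp; rewrite ?mul1r ?mul0r ?br.
by rewrite -mulr_sumr ler_piMr ?mulr_ge0// sum_eq_le1.
Qed.

End pair_mass.

Lemma normc_sum (R : rcfType) (I : Type) (r : seq I) (P : pred I)
    (F : I -> R[i]) :
  normc (\sum_(i <- r | P i) F i) <= \sum_(i <- r | P i) normc (F i).
Proof.
elim/big_ind2: _ => [|x1 x2 y1 y2 h1 h2|//]; first by rewrite normc0.
by rewrite (le_trans (le_normcD _ _))// lerD.
Qed.

Definition conv_on (R : realType) (G : zmodType) (A : seq G)
    (X Y : G -> R[i]) (t : G) : R[i] :=
  \sum_(p <- A) \sum_(q <- A | p + q == t) X p * Y q.

(** A pair discarded by restricting to a has an entry outside a; by symmetry of
    the weight w in X and Y, pairs discarded through their second entry cost as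
    much as those discarded through the first. *)
Lemma conv_on_sub (R : realType) (G : zmodType) (S : seq G) (a : pred G)
    (X Y : G -> R[i]) (t : G) (w := fun s => normc (X s) + normc (Y s)) :
  normc (conv_on [seq s <- S | a s] X Y t - conv_on S X Y t) <=
  (pair_mass S w (predC a) t) *+ 2.
Proof.
have w0 s : 0 <= w s by rewrite addr_ge0// normc_ge0.
have -> : pair_mass S w (predC a) t *+ 2 = \sum_(p <- S) \sum_(q <- S)
    ((~~ a p)%:R + (~~ a q)%:R) * w p * w q * (p + q == t)%:R.
  rewrite mulr2n {2}/pair_mass [X in _ + X]exchange_big -big_split.
  apply: eq_bigr => p _.
  rewrite -big_split; apply: eq_bigr => q _ /=; rewrite [q + p]addrC; ring.
rewrite /conv_on big_filter big_mkcond -sumrB.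
apply: le_trans (normc_sum _ _ _) _; apply: ler_sum => p _.
rewrite big_filter_cond; set B := (X in normc (_ - X)).
have -> : (if a p then \sum_(i <- S | a i && (p + i == t)) X p * Y i
           else 0) - B =
    \sum_(q <- S) (- ((~~ (a p && a q)) && (p + q == t))%:R) * (X p * Y q).
  rewrite {}/B [X in _ - X]big_mkcond.
  case: (a p); rewrite ?sub0r ?[X in X - _]big_mkcond.
    rewrite -sumrB; apply: eq_bigr => q _; rewrite /=.
    by case: (a q); case: (_ == _);
      rewrite /= ?subrr ?oppr0 ?mul0r ?sub0r ?mulN1r.
  rewrite -sumrN; apply: eq_bigr => q _; rewrite /=.
  by case: (_ == _); rewrite /= ?oppr0 ?mul0r ?mulN1r.
apply: le_trans (normc_sum _ _ _) _; apply: ler_sum => q _.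
rewrite normcM normcM.
have XY : normc (X p) * normc (Y q) <= w p * w q.
  by apply: ler_pM; rewrite ?normc_ge0// ?lerDl ?lerDr normc_ge0.
have XY0 : 0 <= w p * w q by rewrite mulr_ge0.
have normN (b : bool) : normc (- (b%:R : R[i])) = b%:R.
  by case: b; rewrite ?oppr0 ?normc0 ?normcN ?normc1.
rewrite normN -[(_ + _) * w p * w q]mulrA.
case: (a p) (a q) (_ == _) => [] [] [];
  rewrite /= ?mul0r ?mulr0 ?mul1r ?mulr1 ?addr0 ?add0r ?mul0r ?mul1r //; lra.
Qed.

Lemma size_level (R : realFieldType) (T : eqType) (S : seq T) (w : T -> R)
    (W r : R) :
  (forall s, 0 <= w s) -> \sum_(s <- S) w s <= W -> 0 < r ->
  (count (fun s => r <= w s) S)%:R <= W / r.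
Proof.
move=> w0 wW r0; rewrite ler_pdivlMr// (le_trans _ wW)// mulr_natl.
rewrite -sum1_count -sumrMnr big_mkcond; apply: ler_sum => s _.
by case: ifP; rewrite ?mulr0n// mulr1n.
Qed.

(** K and theta do not depend on the group.  The thresholds eta decrease so
    fast that weights below eta (k + 1) are negligible even after summation over
    as many group elements as there are sums of two elements of A, where A
    consists of P and of the elements of weight at least eta k.  The entries
    outside A have weight either in the band between the two thresholds, which
    is light for a suitable k, or below eta (k + 1). *)
Lemma concentration (R : realType) (W d : R) : 0 <= W -> 0 < d ->
  exists (K : nat) (theta : R), 0 < theta /\
  forall (G : zmodType) (S P : seq G) (X Y z : G -> R[i]),
  uniq S -> {subset P <= S} -> (size P <= 4)%N ->
  \sum_(s <- S) (normc (X s) + normc (Y s)) <= W ->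
  (forall t, normc (conv_on S X Y t - z t) <= theta) ->
  exists A : seq G, [/\ uniq A, {subset P <= A}, {subset A <= S},
    (size A <= K)%N &
    forall T, uniq T -> (size T <= (size A) ^ 2 + 1)%N ->
      \sum_(t <- T) normc (conv_on A X Y t - z t) <= d].
Proof.
move=> W0 d0.
(* N r bounds (size A) ^ 2 + 1 when A is cut off at the threshold r. *)
pose N (r : R) := (W / r + 4) ^+ 2 + 1.
have N1 r : 0 < r -> 1 <= N r.
  by move=> r0; rewrite /N lerDr exprn_ge0// addr_ge0// divr_ge0// ltW.
pose step r := Num.min r (d / (8 * (W + 1) * N r)).
pose eta k : R := iter k step 1.
have eta_gt0 k : 0 < eta k.
  elim: k => //= k IH; rewrite /step lt_min IH divr_gt0// mulr_gt0//.
    by rewrite mulr_gt0// ltr_wpDl.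
  by rewrite (lt_le_trans _ (N1 _ IH)).
have eta_dec k : eta k.+1 <= eta k by rewrite /= /step ge_min lexx.
have eta_step k : eta k.+1 * W * N (eta k) <= d / 8.
  have N0 : 0 < N (eta k) by rewrite (lt_le_trans _ (N1 _ (eta_gt0 k))).
  have : eta k.+1 <= d / (8 * (W + 1) * N (eta k)).
    by rewrite /= /step ge_min lexx orbT.
  rewrite ler_pdivlMr; last by rewrite mulr_gt0// mulr_gt0// ltr_wpDl.
  move=> H; have : 0 <= eta k.+1 * N (eta k) by rewrite mulr_ge0 ?ltW.
  by move: H; set e := eta k.+1; set n := N _; lra.
pose L := (Num.bound (8 * W ^+ 2 / d)).+1.
have etaL k : (k <= L)%N -> eta L <= eta k.
  move=> /subnKC <-; elim: (L - k)%N => [|m IH]; first by rewrite addn0.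
  by rewrite addnS (le_trans (eta_dec _)).
have NL k : (k <= L)%N -> N (eta k) <= N (eta L).
  move=> kL.
  rewrite /N lerD2r ler_sqr ?nnegrE ?addr_ge0 ?divr_ge0 ?(ltW (eta_gt0 _))//.
  by rewrite lerD2r ler_wpM2l// lef_pV2 ?posrE ?eta_gt0// etaL.
exists (Num.bound (W / eta L + 4)), (d / (2 * N (eta L))); split.
  by rewrite divr_gt0// mulr_gt0// (lt_le_trans _ (N1 _ (eta_gt0 L))).
move=> G S P X Y z uS PS P4 wW approx.
pose w s := normc (X s) + normc (Y s).
have w0 s : 0 <= w s by rewrite addr_ge0// normc_ge0.
have [k kL band] := light_band w0 wW eta_dec (ltn0Sn _ : (0 < L)%N).
pose a s := (eta k <= w s) || (s \in P).
pose A := [seq s <- S | a s].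
have sizeA : (size A)%:R <= W / eta k + 4.
  rewrite /A size_filter; apply: (@le_trans _ _
      ((count (fun s => eta k <= w s) S)%:R + (count (mem P) S)%:R)).
    by rewrite -natrD ler_nat -count_predUI leq_addr.
  rewrite lerD ?size_level// -size_filter ler_nat (leq_trans _ P4)//.
  rewrite uniq_leq_size ?filter_uniq// => s.
  by rewrite mem_filter => /andP[].
exists A; split.
- exact: filter_uniq.
- by move=> s sP; rewrite mem_filter /a sP orbT PS.
- by move=> s; rewrite mem_filter => /andP[].
- rewrite -(ler_nat R) (le_trans sizeA)// (le_trans _ (ltW (archi_boundP _)))//.
    by rewrite lerD2r ler_wpM2l// lef_pV2 ?posrE ?eta_gt0// etaL// ltnW.
  by rewrite addr_ge0// divr_ge0// ltW.
move=> T uT sizeT.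
have TN : (size T)%:R <= N (eta k).
  apply: (@le_trans _ _ (((size A) ^ 2 + 1)%:R)); first by rewrite ler_nat.
  rewrite natrD natrX lerD2r ler_sqr ?nnegrE ?ler0n//.
  by rewrite addr_ge0// divr_ge0// ltW.
pose mid s := eta k.+1 <= w s < eta k.
pose small s := w s < eta k.+1.
have split_mass t : pair_mass S w (predC a) t <=
    pair_mass S w mid t + pair_mass S w small t.
  rewrite /pair_mass -big_split ler_sum// => p _.
  rewrite -big_split ler_sum// => q _ /=.
  rewrite -!mulrDl !ler_wpM2r//.
  rewrite /a negb_or -ltNge.
  case: (ltP (w p) (eta k)) => /= h; last by rewrite addr_ge0.
  rewrite /mid /small h andbT; case: leP => _;
    rewrite ?addr0 ?add0r ?ler1n //; by case: (_ \in _).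
apply: (@le_trans _ _ (\sum_(t <- T)
    ((pair_mass S w mid t + pair_mass S w small t) *+ 2 +
     d / (2 * N (eta L))))).
  apply: ler_sum => t _.
  rewrite -(subrKA (conv_on S X Y t)).
  apply: le_trans (le_normcD _ _) _; apply: lerD; last exact: approx.
  by apply: le_trans (conv_on_sub _ _ _ _ _) _; rewrite lerMn2r split_mass.
rewrite big_split/= sumrMnl big_split/= big_const_seq count_predT iter_addr_0.
have mid_mass : \sum_(t <- T) pair_mass S w mid t <= d / 8.
  apply: le_trans (sum_pair_mass _ w0 _ uT) _.
  have HL : 8 * W ^+ 2 / d <= L%:R.
    rewrite (le_trans (ltW (archi_boundP _))) ?ler_nat//.
    by rewrite divr_ge0 ?mulr_ge0 ?exprn_ge0// ltW.
  move: band; rewrite -/w -/(mid _) => band.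
  set m := (X in X * _); have m0 : 0 <= m by apply: sumr_ge0.
  have {}band : m * L%:R <= W by rewrite mulr_natr.
  have L0 : (0 : R) < L%:R by rewrite ltr0n.
  apply: (@le_trans _ _ (m * W)); first by rewrite ler_wpM2l.
  rewrite -(ler_pM2r L0); move: HL; rewrite ler_pdivrMr// => HL.
  have : m * L%:R * W <= W * W by rewrite ler_wpM2r.
  by move: HL; rewrite expr2; lra.
have small_mass : \sum_(t <- T) pair_mass S w small t <= d / 8.
  apply: (@le_trans _ _ (\sum_(t <- T) (eta k.+1 * W))).
    apply: ler_sum => t _.
    apply: (le_trans (pair_mass_le w0 _ uS (ltW (eta_gt0 k.+1)) _)).
      by move=> s; exact: ltW.
    by rewrite ler_wpM2l// ltW.
  rewrite big_const_seq count_predT iter_addr_0 -[_ *+ _]mulr_natr.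
  apply: le_trans (eta_step k); rewrite ler_wpM2l// mulr_ge0// ltW//.
have rest : d / (2 * N (eta L)) *+ size T <= d / 2.
  have NL0 : 0 < N (eta L) by rewrite (lt_le_trans _ (N1 _ (eta_gt0 L))).
  rewrite -mulr_natr invfM mulrA -mulrA ler_piMr//.
    by rewrite divr_ge0 ?ltW.
  by rewrite ler_pdivrMl// mulr1 (le_trans TN)// NL// ltnW.
by lra.
Qed.

(** * Finite approximation of the convolution *)

Local Open Scope classical_set_scope.

Lemma esum_tail (R : realType) (T : choiceType) (f : T -> R) (P : seq T) (e : R) :
  (forall s, 0 <= f s) -> (\esum_(s in [set: T]) (f s)%:E < +oo)%E -> 0 < e ->
  exists S : seq T, [/\ uniq S, {subset P <= S} &
    (\esum_(s in ~` [set` S]) (f s)%:E <= e%:E)%E].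
Proof.
move=> f0 foo e0.
have ge0 D : (0 <= \esum_(s in D) (f s)%:E)%E.
  by apply: esum_ge0 => s _; rewrite lee_fin.
have fin : (\esum_(s in [set: T]) (f s)%:E)%E \is a fin_num.
  by rewrite ge0_fin_numE.
have [_ [X [finX _] <-] HX] := ub_ereal_sup_adherent e0 fin.
have /finite_seqP[r Xr] := finX.
pose S := undup (P ++ r).
exists S; split; first exact: undup_uniq.
  by move=> s sP; rewrite mem_undup mem_cat sP.
have HS : (\sum_(s \in X) (f s)%:E <=
    \esum_(s in [set: T] `&` [set` S]) (f s)%:E)%E.
  apply: esum_ge; exists X => //; split => // s Xs; split => //=.
  by rewrite mem_undup mem_cat; move: Xs; rewrite Xr /= => ->; rewrite orbT.
rewrite setTI in HS.
have fX : (\sum_(s \in X) (f s)%:E)%E \is a fin_num.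
  by rewrite fsbig_finite//= sumEFin.
move: HX HS fin; rewrite -/(esum _ _) (esumID [set` S]); last first.
  by move=> s _; rewrite lee_fin.
rewrite !setTI fin_numD => + + /andP[].
move: fX (ge0 [set` S]) (ge0 (~` [set` S])).
case: (\sum_(s \in X) (f s)%:E)%E => // a _.
case: (esum [set` S] _) => // b _; case: (esum (~` [set` S]) _) => // c _.
by rewrite -EFinD -EFinB lte_fin !lee_fin => + + _ _; lra.
Qed.

Lemma rsum_split (R : realType) (T : choiceType) (f : T -> R) (S : seq T) :
  uniq S -> (\esum_(s in [set: T]) (`|f s|)%:E < +oo)%E ->
  rsum [set: T] f = \sum_(s <- S) f s + rsum (~` [set` S]) f.
Proof.
move=> uS foo; rewrite /rsum.
have part (g : T -> \bar R) (h : T -> R) :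
    (forall s, g s = (h s)%:E) -> (forall s, 0 <= h s <= `|f s|) ->
    (\esum_(s in [set: T]) g s =
       (\sum_(s <- S) h s)%:E + \esum_(s in ~` [set` S]) g s /\
     \esum_(s in ~` [set` S]) g s \is a fin_num)%E.
  move=> gh h0f.
  have g0 s : (0 <= g s)%E by rewrite gh lee_fin; case/andP: (h0f s).
  have E : (\esum_(s in [set: T]) g s =
      (\sum_(s <- S) h s)%:E + \esum_(s in ~` [set` S]) g s)%E.
    rewrite (esumID [set` S])// !setTI; congr (_ + _)%E.
    rewrite esum_fset// -fsbig_seq// -sumEFin; by apply: eq_bigr.
  split => //; have : (\esum_(s in [set: T]) g s < +oo)%E.
    apply: le_lt_trans foo; apply: le_esum => s _.
    by rewrite gh lee_fin; case/andP: (h0f s).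
  rewrite E ge0_fin_numE ?esum_ge0//; apply: le_lt_trans.
  by rewrite leeDr// lee_fin sumr_ge0// => s _; case/andP: (h0f s).
have absmax (x : R) : 0 <= Num.max x 0 <= `|x|.
  by rewrite le_max lexx orbT ge_max normr_ge0 ler_norm.
have [s|s|-> fp] := part (EFin \o f)^\+%E (fun s => Num.max (f s) 0).
- by rewrite funeposE EFin_max.
- exact: absmax.
have [s|s|-> fn] := part (EFin \o f)^\-%E (fun s => Num.max (- f s) 0).
- by rewrite funenegE EFin_max.
- by rewrite -normrN.
rewrite (_ : \sum_(s <- S) f s = \sum_(s <- S) Num.max (f s) 0 -
    \sum_(s <- S) Num.max (- f s) 0); last first.
  rewrite -sumrB; apply: eq_bigr => s _; have [h|/ltW h] := leP 0 (f s).
    have h' : - f s <= 0 by rewrite oppr_le0.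
    by rewrite (max_idPr h') subr0.
  have h' : 0 <= - f s by rewrite oppr_ge0.
  by rewrite (max_idPl h') sub0r opprK.
move: fp fn; case: (esum _ _) => // a _; case: (esum _ _) => // b _.
by rewrite -!EFinD /=; lra.
Qed.

Lemma rsum_antidiagonal (R : realType) (G : zmodType) (t : G) (f : G * G -> R) :
  rsum [set p | p.1 + p.2 = t] f = rsum [set: G] (fun s => f (s, t - s)).
Proof.
have bij : set_bij [set: G] [set p | p.1 + p.2 = t] (fun s => (s, t - s)).
  split=> [s _ /=|s s' _ _ [->//]|[p q] /= <-]; first by rewrite addrC subrK.
  by exists p => //; rewrite addrC addKr.
rewrite /rsum !(reindex_esum _ _ _ _ bij).
by congr (fine (_ - _)%E); apply: eq_esum => s _; rewrite ?funeposE ?funenegE.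
Qed.

Lemma csum_split (R : realType) (T : choiceType) (f : T -> R[i]) (S : seq T) :
  uniq S -> (\esum_(s in [set: T]) (normc (f s))%:E < +oo)%E ->
  csum [set: T] f = \sum_(s <- S) f s + csum (~` [set` S]) f.
Proof.
move=> uS foo; have sum_ReIm : \sum_(s <- S) f s =
    Complex (\sum_(s <- S) complex.Re (f s)) (\sum_(s <- S) complex.Im (f s)).
  elim: (S) => [|s r IH]; first by rewrite !big_nil.
  by rewrite !big_cons IH; case: (f s).
rewrite sum_ReIm /csum !(rsum_split uS) //.
- apply: le_lt_trans foo; apply: le_esum => s _.
  by rewrite lee_fin; exact: Im_le_normc.
- apply: le_lt_trans foo; apply: le_esum => s _.
  by rewrite lee_fin; exact: Re_le_normc.
Qed.

Section conv_approx.
Variables (R : realType) (G : zmodType).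
Implicit Types x y : ell1 R G.

Lemma ell1_norm_ge0 x : 0 <= ell1_norm x.
Proof.
by rewrite -lee_fin ell1_normE esum_ge0// => s _; rewrite lee_fin normc_ge0.
Qed.

Lemma sum_le_ell1_norm x (S : seq G) : uniq S ->
  \sum_(s <- S) normc (x s) <= ell1_norm x.
Proof.
move=> uS; rewrite -lee_fin ell1_normE esum_ge//; exists [set` S].
  by split => //; exact: finite_seq.
by rewrite -fsbig_seq// sumEFin.
Qed.

Lemma normc_le_ell1_norm x s : normc (x s) <= ell1_norm x.
Proof. by have := @sum_le_ell1_norm x [:: s] isT; rewrite big_seq1. Qed.

Lemma conv_coef_split x y (S : seq G) (t : G) : uniq S ->
  conv_coef x y t = \sum_(s <- S) x s * y (t - s) +
                    csum (~` [set` S]) (fun s => x s * y (t - s)).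
Proof.
move=> uS.
have fin : (\esum_(s in [set: G]) (normc (x s * y (t - s)))%:E < +oo)%E.
  apply: (@le_lt_trans _ _ ((ell1_norm y)%:E *
    \esum_(s in [set: G]) (normc (x s))%:E)%E).
    rewrite -ge0_esumZl ?ell1_norm_ge0//; last first.
      by move=> s; rewrite lee_fin normc_ge0.
    apply: le_esum => s _; rewrite normcM -EFinM lee_fin mulrC.
    by rewrite ler_wpM2r ?normc_ge0 ?normc_le_ell1_norm.
  by rewrite -ell1_normE -EFinM ltry.
by rewrite /conv_coef -(csum_split uS fin) /csum !rsum_antidiagonal.
Qed.

(** The approximation is uniform in t: a finite S carrying all but r of the
    mass of x and of y leaves out, at every t, only pairs with an entry outside
    S, and these contribute at most r times the norm of the other factor. *)
Lemma conv_on_coef x y (P : seq G) (e : R) : 0 < e ->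
  exists S : seq G, [/\ uniq S, {subset P <= S} &
    forall t, normc (conv_on S x y t - conv_coef x y t) <= e].
Proof.
move=> e0; pose N := ell1_norm x + ell1_norm y + 1.
have Nx := ell1_norm_ge0 x; have Ny := ell1_norm_ge0 y.
have N0 : 0 < N by rewrite /N; lra.
have w0 (s : G) : 0 <= normc (x s) + normc (y s) by rewrite addr_ge0// normc_ge0.
have wfin : (\esum_(s in [set: G]) (normc (x s) + normc (y s))%:E < +oo)%E.
  under eq_esum do rewrite EFinD.
  by rewrite esumD -?ell1_normE -?EFinD ?ltry// => s _; rewrite lee_fin normc_ge0.
have r0 : 0 < e / (4 * N) by rewrite divr_gt0// mulr_gt0.
have [S [uS PS tail]] := esum_tail P w0 wfin r0.
set r := e / (4 * N) in r0 tail.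
have tailx : (\esum_(s in ~` [set` S]) (normc (x s))%:E <= r%:E)%E.
  by apply: le_trans tail; apply: le_esum => s _; rewrite lee_fin lerDl normc_ge0.
have taily s : s \notin S -> normc (y s) <= r.
  move=> sS; rewrite -lee_fin; apply: le_trans tail; apply: esum_ge; exists [set s].
    by split => // _ -> /=; exact/negP.
  by rewrite fsbig_set1 lee_fin lerDr normc_ge0.
exists S; split => // t; rewrite (conv_coef_split x y t uS) opprD addrA.
have rN : r * N = e / 4 by rewrite /r invfM mulrA divfK// gt_eqF.
apply: le_trans (le_normcD _ _) _; rewrite normcN.
have -> : e = e / 2 + e / 2 by lra.
apply: lerD.
  rewrite /conv_on -sumrB; apply: le_trans (normc_sum _ _ _) _.
  apply: (@le_trans _ _ (\sum_(p <- S) normc (x p) * r)); last first.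
    rewrite -mulr_suml; apply: (@le_trans _ _ (ell1_norm x * r)).
      by rewrite ler_wpM2r ?sum_le_ell1_norm// ltW.
    by have := mulr_ge0 (ltW r0) Ny; move: rN; rewrite /N; lra.
  apply: ler_sum => p _; have [tS|tS] := boolP (t - p \in S).
    rewrite big_mkcond (bigD1_seq (t - p))//= [p + (t - p)]addrC subrK eqxx big1 ?addr0.
      by rewrite subrr normc0 mulr_ge0 ?normc_ge0// ltW.
    move=> q qt; case: ifP => // /eqP pq.
    by rewrite -pq [p + q]addrC addrK eqxx in qt.
  rewrite big1_seq ?sub0r ?normcN ?normcM ?ler_wpM2l ?normc_ge0 ?taily//.
  move=> q /andP[/eqP pq qS]; move: tS.
  by rewrite -pq [p + q]addrC addrK qS.
have -> : e / 2 = 2 * (r * N) by rewrite rN; lra.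
rewrite -lee_fin; apply: le_trans (normc_csum_le _ _) _.
rewrite EFinM lee_wpmul2l//.
apply: (@le_trans _ _ ((ell1_norm y)%:E *
    \esum_(s in ~` [set` S]) (normc (x s))%:E)%E).
  rewrite -ge0_esumZl//; last by move=> s; rewrite lee_fin normc_ge0.
  apply: le_esum => s _; rewrite normcM -EFinM lee_fin mulrC.
  by rewrite ler_wpM2r ?normc_ge0 ?normc_le_ell1_norm.
apply: (@le_trans _ _ ((ell1_norm y)%:E * r%:E)%E); first by rewrite lee_wpmul2l.
by rewrite -EFinM lee_fin mulrC ler_wpM2l ?ltW// /N; lra.
Qed.

End conv_approx.

(** * Approximate characters *)

Definition cis (R : realType) (a : R) : R[i] := Complex (cos a) (sin a).

Section cis.
Variable R : realType.
Implicit Types a b : R.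

Lemma cisD a b : cis (a + b) = cis a * cis b.
Proof. by apply/eqP; rewrite eq_complex /= cosD sinD eqxx addrC mulrC eqxx. Qed.

Lemma cis0 : cis 0 = 1 :> R[i].
Proof. by rewrite /cis cos0 sin0. Qed.

Lemma normc_cis a : normc (cis a) = 1.
Proof. by rewrite /= cos2Dsin2 sqrtr1. Qed.

Lemma lipschitz1 (f df : R -> R) a b :
  (forall x, is_derive x (1 : R) f (df x)) -> (forall x, `|df x| <= 1) ->
  `|f a - f b| <= `|a - b|.
Proof.
move=> fdf df1; wlog ab : a b / a <= b => [H|].
  by have [/H//|/ltW/H] := leP a b; rewrite distrC [leRHS]distrC.
rewrite distrC [leRHS]distrC.
have cf : {within `[a, b], continuous f}.
  apply: continuous_subspaceT => x.
  by apply: differentiable_continuous; apply/derivable1_diffP; have [] := fdf x.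
have [c _ ->] := MVT_segment ab (fun x _ => fdf x) cf.
by rewrite normrM ler_piMl.
Qed.

Lemma cis_lipschitz a b : normc (cis a - cis b) <= 2 * `|a - b|.
Proof.
rewrite (le_trans (normc_le_ReIm _))//= mulr_natl mulr2n lerD//.
  by apply: (@lipschitz1 _ (fun x => - sin x)) => x; rewrite normrN sin_max.
by apply: (@lipschitz1 _ cos) => x; exact: cos_max.
Qed.

End cis.

(** A quantitative form of the Poincare-Miranda theorem: the real part changes
    sign between the vertical sides, the imaginary part between the horizontal
    ones. *)
Lemma planar_zero (R : realType) (F : R -> R -> R[i]) (l B c : R) :
  0 <= l ->
  (forall s t s' t', normc (F s t - F s' t') <= B * (`|s - s'| + `|t - t'|)) ->
  (forall t, 0 < complex.Re (F 0 t)) -> (forall t, complex.Re (F l t) < 0) ->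
  (forall s, 0 < complex.Im (F s 0)) -> (forall s, complex.Im (F s l) < 0) ->
  0 < c -> exists s t, normc (F s t) < c.
Proof.
move=> l0 lip left right bottom top c0.
have B0 : 0 <= B.
  have := lip 0 0 1 0; rewrite subrr normr0 addr0 sub0r normrN normr1 mulr1.
  exact: le_trans (normc_ge0 _).
pose n := (Num.bound (4 * B * l / c)).+1.
have n0 : 0 < n%:R :> R by rewrite ltr0n.
pose node i : R := l * i%:R / n%:R.
have node0 : node 0%N = 0 by rewrite /node mulr0 mul0r.
have noden : node n = l by rewrite /node mulfK// gt_eqF.
have near_node i (a : bool) : `|node (a + i)%N - node i| <= l / n%:R.
  have -> : node (a + i)%N - node i = a%:R * (l / n%:R).
    by rewrite /node natrD; ring.
  have ln : 0 <= l / n%:R by rewrite divr_ge0// ltW.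
  by case: a; rewrite ?mul1r ?mul0r ?normr0// ger0_norm.
(* r bounds the oscillation of F over one cell of the grid. *)
pose r := 2 * B * l / n%:R.
have r2 : 2 * r < c.
  rewrite /r mulrA ltr_pdivrMr// [c * _]mulrC -ltr_pdivrMr//.
  apply: (@lt_le_trans _ _ (Num.bound (4 * B * l / c))%:R).
    by rewrite (le_lt_trans _ (archi_boundP _)) ?divr_ge0 ?mulr_ge0 ?(ltW c0)//; lra.
  by rewrite ler_nat leqnSn.
have [|||||i [j [_ _ u0 v0]]] := @grid_near_zero R n
    (fun i j => complex.Re (F (node i) (node j)))
    (fun i j => complex.Im (F (node i) (node j))) r.
- by move=> j _; rewrite node0.
- by move=> j _; rewrite noden.
- by move=> i _; rewrite node0.
- by move=> i _; rewrite noden.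
- move=> i j a b _ _.
  have H : normc (F (node (a + i)%N) (node (b + j)%N) -
                  F (node i) (node j)) <= r.
    apply: le_trans (lip _ _ _ _) _.
    have -> : r = B * (l / n%:R + l / n%:R) by rewrite /r; lra.
    by rewrite ler_wpM2l// lerD// near_node.
  by split; rewrite -raddfB; apply: le_trans H; [exact: Re_le_normc|exact: Im_le_normc].
exists (node i), (node j); apply: le_lt_trans r2.
by rewrite (le_trans (normc_le_ReIm _))//; move: u0 v0 => /=; lra.
Qed.

Definition char_sum (R : realType) (G : zmodType) (A : seq G) (X : G -> R[i])
    (f : G -> R) : R[i] :=
  \sum_(p <- A) X p * cis (f p).

(** On A the map p |-> cis (f p) is multiplicative as far as sums of two
    elements of A can tell: f p + f q depends only on p + q, and vanishes when
    p + q does.  Hence it turns the convolution of functions on A into a product,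
    as a character of the group would. *)
Lemma char_sum_conv (R : realType) (G : zmodType) (A : seq G) (X Y z : G -> R[i])
    (f : G -> R) (d : R) :
  freiman_hom A f -> (forall t, t != 0 -> z t = 0) ->
  (forall T, uniq T -> (size T <= (size A) ^ 2 + 1)%N ->
     \sum_(t <- T) normc (conv_on A X Y t - z t) <= d) ->
  normc (char_sum A X f * char_sum A Y f - z 0) <= d.
Proof.
move=> [f_add f_opp] z0 Hd.
(* phi t is the common value of f p + f q over p + q = t. *)
have /choice[phi phiP] : forall t, exists r,
    (forall p q, p \in A -> q \in A -> p + q = t -> f p + f q = r) /\
    (t = 0 -> r = 0).
  move=> t; have [->|tn0] := eqVneq t 0.
    by exists 0; split => // p q pA qA; exact: f_opp.
  have [[p [q [pA qA pq]]]|none] :=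
    EM (exists p q, [/\ p \in A, q \in A & p + q = t]).
    exists (f p + f q); split => [p' q' p'A q'A pq'|t0]; last first.
      by rewrite t0 eqxx in tn0.
    by apply: f_add => //; rewrite pq' pq.
  exists 0; split => // p q pA qA pq; exfalso; apply: none; exists p, q.
  by split.
pose T := undup (0 :: [seq p + q | p <- A, q <- A]).
have uT : uniq T by exact: undup_uniq.
have sT : (size T <= (size A) ^ 2 + 1)%N.
  by rewrite (leq_trans (size_undup _))//= size_allpairs addn1 mulnn.
have T0 : 0 \in T by rewrite mem_undup inE eqxx.
have prodE : char_sum A X f * char_sum A Y f =
    \sum_(t <- T) conv_on A X Y t * cis (phi t).
  rewrite /char_sum /conv_on mulr_suml.
  under [RHS]eq_bigr do rewrite mulr_suml.
  rewrite exchange_big big_seq [RHS]big_seq; apply: eq_bigr => p pA.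
  rewrite mulr_sumr; under [RHS]eq_bigr do rewrite big_mkcond mulr_suml.
  rewrite exchange_big big_seq [RHS]big_seq; apply: eq_bigr => q qA /=.
  have pqT : p + q \in T by rewrite mem_undup inE allpairs_f ?orbT.
  rewrite (bigD1_seq (p + q))//= eqxx big1 => [|t]; last first.
    by rewrite eq_sym => /negbTE->; rewrite mul0r.
  by rewrite addr0 -((phiP (p + q)).1 p q)// cisD mulrACA.
have zE : z 0 = \sum_(t <- T) z t * cis (phi t).
  rewrite (bigD1_seq 0)//= big1 => [|t /z0->]; last by rewrite mul0r.
  by rewrite addr0 (phiP 0).2// cis0 mulr1.
rewrite prodE {1}zE -sumrB (le_trans _ (Hd T uT sT))//.
apply: le_trans (normc_sum _ _ _) _; apply: ler_sum => t _.
by rewrite -mulrBl normcM normc_cis mulr1.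
Qed.

Lemma char_sum_le (R : realType) (G : zmodType) (A : seq G) (X : G -> R[i])
    (f : G -> R) :
  normc (char_sum A X f) <= \sum_(p <- A) normc (X p).
Proof.
apply: le_trans (normc_sum _ _ _) _; apply: ler_sum => p _.
by rewrite normcM normc_cis mulr1.
Qed.

Lemma char_sum_lipschitz (R : realType) (G : zmodType) (A : seq G) (X : G -> R[i])
    (lam mu : G -> R) : exists B, forall s t s' t',
  normc (char_sum A X (fun p => s * lam p + t * mu p) -
         char_sum A X (fun p => s' * lam p + t' * mu p)) <=
  B * (`|s - s'| + `|t - t'|).
Proof.
exists (\sum_(p <- A) normc (X p) * (2 * (`|lam p| + `|mu p|))) => s t s' t'.
rewrite /char_sum -sumrB mulr_suml.
apply: le_trans (normc_sum _ _ _) _; apply: ler_sum => p _.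
rewrite -mulrBr normcM -mulrA ler_wpM2l ?normc_ge0//.
apply: le_trans (cis_lipschitz _ _) _; rewrite -mulrA ler_wpM2l//.
have -> : s * lam p + t * mu p - (s' * lam p + t' * mu p) =
   (s - s') * lam p + (t - t') * mu p by ring.
apply: le_trans (ler_normD _ _) _; rewrite !normrM.
have := mulr_ge0 (normr_ge0 (lam p)) (normr_ge0 (t - t')).
have := mulr_ge0 (normr_ge0 (mu p)) (normr_ge0 (s - s')).
by lra.
Qed.

(** * Elements without small relations and the test element *)

Lemma large_order_element (R : realType) (G : zmodType) (N : nat) :
  unbounded_exponent R G ->
  exists g : G, forall n : nat, (0 < n <= N)%N -> g *+ n != 0.
Proof.
move=> sup_oo; have /ereal_sup_gt[_ [g _ <-]] :
    (N%:R%:E < ereal_sup (range (group_order R (G := G))))%E by rewrite sup_oo ltry.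
move=> Ng; exists g => n /andP[n0 nN]; apply/negP => /eqP gn.
move: Ng; rewrite ltNge => /negP; apply.
apply: (@le_trans _ _ (n%:R)%:E); last by rewrite lee_fin ler_nat.
by apply: ereal_inf_lbound; exists n.
Qed.

(** A relation k g + l (M + 1) g = 0 makes k + l (M + 1) a multiple of the
    order of g; being smaller than the order, it vanishes, and then k = l = 0
    because k is smaller than M + 1. *)
Lemma sparse_independent (G : zmodType) (g : G) (M : nat) :
  (forall n : nat, (0 < n <= M + M * M.+1)%N -> g *+ n != 0) ->
  forall k l : int, (`|k| <= M)%N -> (`|l| <= M)%N ->
    g *~ k + (g *+ M.+1) *~ l = 0 -> k = 0 /\ l = 0.
Proof.
move=> g_order k l kM lM.
rewrite pmulrn -mulrzA -mulrzDr.
have [kl0 _|kl0] := eqVneq (k + M.+1%:Z * l) 0.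
  have l0 : l = 0 by nia.
  by split => //; rewrite l0 in kl0; lia.
move=> gz; exfalso.
have bound : (0 < `|(k + M.+1%:Z * l)%R| <= M + M * M.+1)%N by nia.
have /eqP := g_order _ bound; apply; move: gz {bound kl0}.
case: (k + _) => n //=; rewrite NegzE mulrNz => /eqP.
by rewrite oppr_eq0 => /eqP.
Qed.

Lemma half_complex (R : rcfType) : (2^-1 : R[i]) = Complex 2^-1 0.
Proof. by rewrite -[RHS]/((2^-1)%:C%C) fmorphV rmorph_nat. Qed.

Section unit_vectors.
Variables (R : realType) (G : zmodType).
Implicit Types (g : G) (x y : ell1 R G).

Lemma esum_unit g :
  (\esum_(s in [set: G]) (normc ((s == g)%:R : R[i]))%:E = 1)%E.
Proof.
rewrite -(@esum_set1 R G g (fun=> 1%E)) ?lee_fin// [RHS]esum_mkcond.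
apply: eq_esum => s _; have -> : (s \in [set g]) = (s == g).
  by apply/idP/eqP; rewrite in_setE.
case: eqP => _.
  by rewrite normc1.
by rewrite normc0.
Qed.

Lemma unit_summable g : (fun s => (s == g)%:R : R[i]^o) \in @abs_summable R G.
Proof. by apply/asboolP; rewrite esum_unit ltry. Qed.

Definition ell1_unit g : ell1 R G := Ell1 (unit_summable g).

Lemma ell1_norm_unit g : ell1_norm (ell1_unit g) = 1.
Proof. by rewrite /ell1_norm esum_unit. Qed.

Lemma ell1_normD_le x y : ell1_norm (x + y) <= ell1_norm x + ell1_norm y.
Proof. by rewrite -lecR rmorphD ler_ell1_normD. Qed.

Lemma ell1_normZE (a : R[i]) x : ell1_norm (a *: x) = normc a * ell1_norm x.
Proof. by apply: (@complexI R); rewrite rmorphM; exact: ell1_normZ. Qed.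

Lemma ell1_conv0 x : ell1_conv x 0 = 0.
Proof.
apply/val_inj/funext => t /=; apply: eq0_normc; apply/eqP.
rewrite eq_le normc_ge0 andbT -lee_fin; apply: le_trans (normc_csum_le _ _) _.
by rewrite esum1 ?mule0// => p _; rewrite mulr0 normc0.
Qed.

(** The Fourier transform of this element at a character with value exp(i s)
    at g and exp(i t) at h is cos s + i cos t. *)
Definition test_element g h : ell1 R G :=
  (2^-1 : R[i]) *: (ell1_unit g + ell1_unit (- g)) +
  (Complex 0 2^-1) *: (ell1_unit h + ell1_unit (- h)).

Lemma test_elementE g h p : test_element g h p =
  2^-1 * ((p == g)%:R + (p == - g)%:R) +
  Complex 0 2^-1 * ((p == h)%:R + (p == - h)%:R).
Proof. by []. Qed.

Lemma ell1_norm_test g h : ell1_norm (test_element g h) <= 2.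
Proof.
have n1 : normc (2^-1 : R[i]) = 2^-1.
  by rewrite half_complex /= expr0n addr0 sqrtr_sqr ger0_norm ?invr_ge0.
have n2 : normc (Complex 0 2^-1 : R[i]) = 2^-1.
  by rewrite /= expr0n add0r sqrtr_sqr ger0_norm ?invr_ge0.
have := ell1_normD_le (ell1_unit g) (ell1_unit (- g)).
have := ell1_normD_le (ell1_unit h) (ell1_unit (- h)).
rewrite !ell1_norm_unit => hg hh; apply: le_trans (ell1_normD_le _ _) _.
by rewrite !ell1_normZE n1 n2; lra.
Qed.

Lemma char_sum_test (A : seq G) (f : G -> R) g h : uniq A ->
  g \in A -> - g \in A -> h \in A -> - h \in A ->
  f (- g) = - f g -> f (- h) = - f h ->
  char_sum A (test_element g h) f = Complex (cos (f g)) (cos (f h)).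
Proof.
move=> uA gA gA' hA hA' fg fh.
have pick s : s \in A -> \sum_(p <- A) (p == s)%:R * cis (f p) = cis (f s).
  move=> sA; rewrite (bigD1_seq s)//= eqxx mul1r big1 ?addr0// => p /negbTE->.
  by rewrite mul0r.
rewrite /char_sum; under eq_bigr do rewrite test_elementE mulrDl -!mulrA !mulrDl.
rewrite big_split/= -!mulr_sumr !big_split/= !pick// fg fh /cis !cosN !sinN.
rewrite half_complex.
apply/eqP; rewrite eq_complex /= !(mul0r, mulr0, subr0, addr0, add0r, subrr).
by apply/andP; split; apply/eqP; field.
Qed.

End unit_vectors.

Lemma freiman_hom_lin (R : realType) (G : zmodType) (A : seq G)
    (lam mu : G -> R) (s t : R) :
  freiman_hom A lam -> freiman_hom A mu ->
  freiman_hom A (fun p => s * lam p + t * mu p).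
Proof.
move=> [lam_add lam_opp] [mu_add mu_opp]; split.
  move=> p q pA qA p' q' p'A q'A pq.
  rewrite [LHS]addrACA [RHS]addrACA -!mulrDr.
  by congr (_ * _ + _ * _); [exact: lam_add|exact: mu_add].
move=> p q pA qA pq.
by rewrite addrACA -!mulrDr lam_opp// mu_opp// !mulr0 addr0.
Qed.

(** * The obstruction *)

(** If X * Y is close to d e_0, then the character sum F of X satisfies
    |F H - d| <= d / 2 with |H| <= 1, so |F| >= d / 2 everywhere.  On the other
    hand F stays within 1 of cos s + i cos t, whose real part changes sign
    between s = 0 and s = pi, and whose imaginary part changes sign between
    t = 0 and t = pi; so F comes arbitrarily close to 0. *)
Lemma no_inverse_near_test_element (R : realType) (G : zmodType) (g h : G)
    (A : seq G) (X Y z : G -> R[i]) (lam mu : G -> R) (d : R) :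
  0 < d -> uniq A -> {subset [:: g; - g; h; - h] <= A} ->
  freiman_hom A lam -> freiman_hom A mu ->
  lam g = 1 /\ lam h = 0 -> mu g = 0 /\ mu h = 1 ->
  \sum_(p <- A) normc (X p - test_element R g h p) < 1 ->
  \sum_(p <- A) normc (Y p) <= 1 ->
  (forall t, t != 0 -> z t = 0) -> z 0 = (d%:C)%C ->
  ~ (forall T, uniq T -> (size T <= (size A) ^ 2 + 1)%N ->
     \sum_(t <- T) normc (conv_on A X Y t - z t) <= d / 2).
Proof.
move=> d0 uA PA lam_hom mu_hom [lg lh] [mg mh] X1 Y1 z0 zd conv.
have gA : g \in A by apply: PA; rewrite !inE eqxx.
have gA' : - g \in A by apply: PA; rewrite !inE eqxx ?orbT.
have hA : h \in A by apply: PA; rewrite !inE eqxx ?orbT.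
have hA' : - h \in A by apply: PA; rewrite !inE eqxx ?orbT.
pose f s t p := s * lam p + t * mu p.
have f_hom s t : freiman_hom A (f s t) by exact: freiman_hom_lin.
pose F s t := char_sum A X (f s t).
have F_symbol s t : normc (F s t - Complex (cos s) (cos t)) < 1.
  have f_opp p : p \in A -> - p \in A -> f s t (- p) = - f s t p.
    move=> pA pA'; apply/eqP; rewrite -addr_eq0 addrC.
    by rewrite (f_hom s t).2 ?subrr.
  have <- : char_sum A (test_element R g h) (f s t) = Complex (cos s) (cos t).
    rewrite char_sum_test ?f_opp// /f lg lh mg mh.
    by rewrite !mulr0 !mulr1 addr0 add0r.
  rewrite /F /char_sum -sumrB; apply: le_lt_trans (normc_sum _ _ _) _.
  apply: le_lt_trans X1; apply: ler_sum => p _.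
  by rewrite -mulrBl normcM normc_cis mulr1.
have F_Re s t : `|complex.Re (F s t) - cos s| < 1.
  apply: le_lt_trans (F_symbol s t).
  rewrite -[cos s]/(complex.Re (Complex (cos s) (cos t))).
  by rewrite -raddfB; exact: Re_le_normc.
have F_Im s t : `|complex.Im (F s t) - cos t| < 1.
  apply: le_lt_trans (F_symbol s t).
  rewrite -[cos t]/(complex.Im (Complex (cos s) (cos t))).
  by rewrite -raddfB; exact: Im_le_normc.
have [B F_lip] := char_sum_lipschitz A X lam mu.
have [t|t|s|s||s [t Fst]] := @planar_zero R F pi B (d / 2) (pi_ge0 R) F_lip.
- by have := F_Re 0 t; rewrite cos0 ltr_norml; lra.
- by have := F_Re pi t; rewrite cospi ltr_norml; lra.
- by have := F_Im s 0; rewrite cos0 ltr_norml; lra.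
- by have := F_Im s pi; rewrite cospi ltr_norml; lra.
- by rewrite divr_gt0.
have H1 := le_trans (char_sum_le A Y (f s t)) Y1.
have := char_sum_conv (f_hom s t) z0 conv; rewrite -/(F s t).
set H := char_sum A Y _ in H1 *; rewrite zd => FH.
have : normc (d%:C%C : R[i]) <= normc (F s t * H) + d / 2.
  rewrite -[X in normc X](subKr (F s t * H)); apply: le_trans (le_normcD _ _) _.
  by rewrite normcN lerD2l.
rewrite normcM /= expr0n addr0 sqrtr_sqr gtr0_norm//.
have : normc (F s t) * normc H <= normc (F s t) by rewrite ler_piMr ?normc_ge0.
by lra.
Qed.

Theorem theoremB (R : realType) (G : zmodType)
  (hG : unbounded_exponent R G) :
  ~ uniformly_open
      (fun xy : (ell1 R G * ell1 R G)%type => ell1_conv xy.1 xy.2).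
Proof.
move=> conv_open.
have half_gt0 : 0 < (2^-1 : R)%:C%C by rewrite ltcR invr_gt0.
have [d' d'0 open_d] := conv_open _ half_gt0.
pose d := complex.Re d'.
have d'E : d' = d%:C%C.
  by move: d'0; rewrite /d; case: (d') => a b; rewrite ltcE /= => /andP[/eqP->].
have d0 : 0 < d by rewrite -ltcR -d'E.
have [K [theta [theta0 conc]]] :=
  @concentration R 3 (d / 4) ltac:(by []) ltac:(by rewrite divr_gt0).
(* K bounds the size of A, M depends on K, and only then is g chosen. *)
have [M coordinates] := freiman_coordinates R K.
have [g g_order] := large_order_element (M + M * M.+1) hG.
have indep := sparse_independent g_order; set h := g *+ M.+1 in indep.
pose x := test_element R g h.
pose z : ell1 R G := ((d / 2)%:C)%C *: ell1_unit R 0.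
have zE t : z t = (d / 2)%:C%C * (t == 0)%:R by [].
have d2_norm : normc ((d / 2)%:C%C : R[i]) = d / 2.
  by rewrite /= expr0n addr0 sqrtr_sqr gtr0_norm ?divr_gt0.
have [|[x' y'] [/= xx' yy'] conv_xy] := open_d (x, 0) z.
  rewrite /= ell1_conv0 d'E; apply/ball_ell1E.
  rewrite sub0r -scaleN1r scalerA mulN1r ell1_normZE normcN d2_norm.
  rewrite ell1_norm_unit mulr1.
  lra.
move: xx' yy' => /ball_ell1E xx' /ball_ell1E yy'.
have yN : ell1_norm y' < 2^-1.
  by move: yy'; rewrite sub0r -scaleN1r ell1_normZE normcN normc1 mul1r.
have xx'N : ell1_norm (x' - x) < 2^-1.
  by rewrite -opprB -scaleN1r ell1_normZE normcN normc1 mul1r.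
have xN : ell1_norm x' <= 2 + 2^-1.
  have := ell1_normD_le (x' - x) x; have := @ell1_norm_test R G g h.
  by rewrite -/x subrK; lra.
have [S [uS PS approx]] := conv_on_coef x' y' [:: g; - g; h; - h] theta0.
have [|t|A [uA PA AS AK convA]] :=
  conc G S [:: g; - g; h; - h] x' y' z uS PS (leqnn 4).
- rewrite big_split /=; have := sum_le_ell1_norm x' uS; have := sum_le_ell1_norm y' uS.
  lra.
- by rewrite -conv_xy; exact: approx.
have gA : g \in A by apply: PA; rewrite !inE eqxx.
have hA : h \in A by apply: PA; rewrite !inE eqxx ?orbT.
have [lam [mu [lam_hom mu_hom lamE muE]]] := coordinates G A g h AK gA hA indep.
apply: (@no_inverse_near_test_element R G g h A x' y' z lam mu (d / 2)) => //.
- by rewrite divr_gt0.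
- have := sum_le_ell1_norm (x' - x) uA; move: xx'N => /[swap] /le_lt_trans /[apply] H.
  by apply: lt_trans H _; lra.
- by have := sum_le_ell1_norm y' uA; lra.
- by move=> t t0; rewrite zE (negbTE t0) mulr0.
- by rewrite zE eqxx mulr1.
- by move=> T uT sT; have := convA T uT sT; lra.
Qed.
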